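(* Let $d\ge 1$ and $n\ge 1$ be integers, and let $P\in\mathbb R[x_1,\ldots,x_d]$ be a polynomial of degree $n$ (not necessarily homogeneous) whose restriction to the unit sphere $S^{d-1}\subset\mathbb R^d$ is not identically zero. If $|P|$ restricted to $S^{d-1}$ attains its maximum at a point $p\in S^{d-1}$, then $p$ is at angular distance at least $\frac{\pi}{2n}$ from the intersection of the zero set of $P$ with $S^{d-1}$.
   Context: $S^{d-1}$ is the Euclidean unit sphere centered at the origin of $\mathbb R^d$. The angular distance between $u,v\in S^{d-1}$ is $\arccos\langle u,v\rangle\in[0,\pi]$. ''The point $p$ is at angular distance at least $r$ from a set $Z$'' means that every $z\in Z$ is at angular distance at least $r$ from $p$ (vacuously true if $Z$ is empty). *)

(* Defs.v *)
From mathcomp Require Import all_boot all_order all_algebra.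
From mathcomp Require Import classical_sets reals trigo.
(* The notations of mpoly.v are incompatible with those of the analysis
   library, hence the filtered import. *)
From mathcomp.multinomials Require Import -(notations) mpoly.

Set Implicit Arguments.
Unset Strict Implicit.
Unset Printing Implicit Defensive.

Import Order.TTheory GRing.Theory Num.Theory.

Local Open Scope classical_set_scope.
Local Open Scope ring_scope.

Definition dotprod (R : realType) (d : nat) (u v : 'rV[R]_d) : R :=
  \sum_(i < d) u ord0 i * v ord0 i.

(* The library norm `|x| on 'rV[R]_d is the sup norm. *)
Definition euclidean_norm (R : realType) (d : nat) (x : 'rV[R]_d) : R :=
  Num.sqrt (dotprod x x).

(* This is S^{d-1}: the index d is the dimension of the ambient space. *)
Definition unit_sphere (R : realType) (d : nat) : set 'rV[R]_d :=
  [set x | euclidean_norm x = 1].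
Arguments unit_sphere : clear implicits.

Definition angular_dist (R : realType) (d : nat) (u v : 'rV[R]_d) : R :=
  acos (dotprod u v).

Definition at_angular_dist_ge (R : realType) (d : nat) (r : R)
    (p : 'rV[R]_d) (Z : set 'rV[R]_d) : Prop :=
  forall z, Z z -> r <= angular_dist p z.

Definition peval (R : realType) (d : nat) (P : mpoly d R) (x : 'rV[R]_d) : R :=
  meval (x ord0) P.

(* As for univariate polynomials, mmeasure mdeg P (the msize of mpoly.v) is
   the total degree plus one, and 0 when P = 0. *)
Definition has_degree (R : realType) (d : nat) (P : mpoly d R) (n : nat) : Prop :=
  mmeasure mdeg P = n.+1.

Definition zero_set (R : realType) (d : nat) (P : mpoly d R) : set 'rV[R]_d :=
  [set x | peval P x = 0].

(* Main.v *)
Require Import Defs.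
From mathcomp Require Import all_boot all_order all_algebra.
From mathcomp Require Import classical_sets reals trigo.
From mathcomp.multinomials Require Import -(notations) mpoly.
From mathcomp Require Import ring lra zify.

Set Implicit Arguments.
Unset Strict Implicit.
Unset Printing Implicit Defensive.

Import Order.TTheory GRing.Theory Num.Theory.

Local Open Scope classical_set_scope.
Local Open Scope ring_scope.

(** A zero z of P with z <> p, -p spans with p a great circle
    t |-> cos t *: p + sin t *: q, on which p sits at t = 0 and z at the angle
    theta between p and z.  Along it P is a trigonometric polynomial T of degree
    at most n, and after division by P p one has |T| <= 1, T 0 = 1 and
    T theta = 0.  So the theorem reduces to M. Riesz's lemma that a trigonometric
    polynomial of degree at most n has no zero closer than pi / (2 n) to a point
    where its absolute value is maximal ([trig_poly_zero_far_from_max]).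

    The lemma is proved by counting sign changes of
      D t = A * cos (n (t + a)) - T t
    over one period.  At the 2 n extremal points of the cosine, which are spaced
    by pi / n, the cosine term has absolute value A, so as soon as A > 1 the
    difference D takes there the sign of the cosine, and these signs alternate.
    If theta < pi / (2 n), a small shift a > 0 and an A slightly above 1 can be
    chosen so that also D 0 < 0 (since T 0 = 1) and D theta > 0 (since
    T theta = 0), although 0 and theta lie between two consecutive extremal points,
    where D is positive at the left one and negative at the right one.  This
    gives 2 n + 2 points of alternating sign inside ]-pi, pi[, hence 2 n + 1
    zeros there ([trig_poly_two_extra_signs]).  But in the variable tan (t / 2) a
    trigonometric polynomial of degree at most n is, up to a positive factor, a
    polynomial of degree at most 2 n ([trig_poly_alternating]).

    All sign conditions are strict: no derivative and no multiplicity of a zero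
    has to be considered. *)

(** * Sign changes of a univariate polynomial *)

(** Each sign change produces a root, and a nonzero polynomial has fewer roots
    than its size. *)
Lemma alternating_size_gt (R : rcfType) (Q : {poly R}) (s : nat -> R) (m : nat) :
    (forall j, (j < m)%N -> s j < s j.+1) ->
    (forall j, (j <= m)%N -> 0 < (-1) ^+ j * Q.[s j]) ->
  (m < size Q)%N.
Proof.
move=> s_incr Q_alt.
have Q_neq0 : Q != 0.
  by apply/eqP => Q0; have := Q_alt 0 isT; rewrite Q0 horner0 mulr0 ltxx.
(* The bound by s m makes each new root distinct from the previous ones. *)
suff [rs [size_rs uniq_rs root_rs _]] : exists rs : seq R,
    [/\ size rs = m, uniq rs, all (root Q) rs & all (fun r => r < s m) rs].
  by rewrite -size_rs; apply: max_poly_roots.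
elim: m s_incr Q_alt => [|m IHm] s_incr Q_alt; first by exists [::].
have [||rs [size_rs uniq_rs root_rs rs_lt]] := IHm.
- by move=> j lt_jm; apply: s_incr; apply: leqW.
- by move=> j le_jm; apply: Q_alt; apply: leqW.
have s_lt := s_incr m (leqnn _).
have Qm := Q_alt m (leqnSn _); have QSm := Q_alt m.+1 (leqnn _).
have [|r /andP[ge_r le_r] root_r] :=
    @poly_ivt _ ((-1) ^+ m.+1 *: Q) _ _ (ltW s_lt).
  rewrite !hornerZ (ltW QSm) andbT exprS -mulrA mulN1r oppr_le0; exact: ltW.
have {}root_r : root Q r by rewrite rootZ ?signr_eq0 in root_r.
have neq_r k : (k <= m.+1)%N -> r != s k.
  move=> le_k; apply/eqP => r_k; have := Q_alt k le_k.
  by rewrite -r_k (rootP root_r) mulr0 ltxx.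
exists (r :: rs); split=> /=; last 2 first.
- by rewrite root_r.
- rewrite lt_neqAle le_r neq_r //=.
  by apply: sub_all rs_lt => x /lt_trans; apply.
- by rewrite size_rs.
rewrite uniq_rs andbT; apply/negP => /(allP rs_lt).
by rewrite ltNge ge_r.
Qed.

(** * Trigonometric polynomials *)

Section TrigonometricPolynomials.
Variable R : realType.
Implicit Types (f g : R -> R) (n : nat).

(** Trigonometric polynomials of degree at most n, in terms of s = tan (t / 2):
    cos t and sin t are (1 - s^2) / (1 + s^2) and 2 s / (1 + s^2), so that
    (1 + s^2)^n clears the denominators and leaves a polynomial of degree at most
    2 n.  This describes f on ]-pi, pi[ only, the range of 2 atan. *)
Definition trig_poly n f := exists2 Q : {poly R}, (size Q <= (2 * n).+1)%N &
  forall s, Q.[s] = (1 + s ^+ 2) ^+ n * f (atan s *+ 2).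

Lemma eq_trig_poly n f g : f =1 g -> trig_poly n f -> trig_poly n g.
Proof. by move=> eq_fg [Q ? Q_s]; exists Q => // s; rewrite Q_s eq_fg. Qed.

Lemma trig_polyD n f g :
  trig_poly n f -> trig_poly n g -> trig_poly n (fun t => f t + g t).
Proof.
move=> [Qf size_f Qf_s] [Qg size_g Qg_s]; exists (Qf + Qg).
  by rewrite (leq_trans (size_polyD _ _)) // geq_max size_f.
by move=> s; rewrite hornerD Qf_s Qg_s mulrDr.
Qed.

Lemma trig_polyM n m f g :
  trig_poly n f -> trig_poly m g -> trig_poly (n + m) (fun t => f t * g t).
Proof.
move=> [Qf size_f Qf_s] [Qg size_g Qg_s]; exists (Qf * Qg).
  rewrite (leq_trans (size_polyMleq _ _)) // mulnDr.
  by move: size_f size_g; case: (size Qf) => [|a]; case: (size Qg) => [|b]; lia.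
by move=> s; rewrite hornerM Qf_s Qg_s exprD mulrACA.
Qed.

Lemma trig_polyC c : trig_poly 0 (fun=> c).
Proof.
by exists c%:P => [|s]; rewrite ?size_polyC_leq1 // hornerC expr0 mul1r.
Qed.

Lemma trig_polyZ n c f : trig_poly n f -> trig_poly n (fun t => c * f t).
Proof. exact: (trig_polyM (trig_polyC c)). Qed.

(** The degree in s is raised by the powers of 1 + s^2, which stands for the
    constant 1 written as cos^2 + sin^2. *)
Lemma trig_poly_le m n f : (m <= n)%N -> trig_poly m f -> trig_poly n f.
Proof.
move=> le_mn [Q size_Q Q_s]; pose W : {poly R} := 1 + 'X ^+ 2.
exists (W ^+ (n - m) * Q) => [|s]; last first.
  rewrite hornerM Q_s horner_exp hornerD hornerXn hornerC.
  by rewrite mulrA -exprD subnK.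
have size_W : (size W <= 3)%N.
  by rewrite (leq_trans (size_polyD _ _)) // size_polyXn size_poly1.
have size_Wk := size_poly_exp_leq W (n - m).
have le_Wk : ((size W).-1 * (n - m) <= 2 * (n - m))%N.
  by apply: leq_mul => //; lia.
rewrite (leq_trans (size_polyMleq _ _)) //; lia.
Qed.

Lemma sqr_cos_atan (s : R) : (1 + s ^+ 2) * cos (atan s) ^+ 2 = 1.
Proof.
have cos_neq0 : cos (atan s) != 0.
  by rewrite gt_eqF // cos_gt0_pihalf // atan_gtNpi2 atan_ltpi2.
by rewrite -{1}[s]atanK -cos2_tan2 // mulVf // expf_neq0.
Qed.

Lemma sin_atan (s : R) : sin (atan s) = s * cos (atan s).
Proof.
have cos_neq0 : cos (atan s) != 0.
  by rewrite gt_eqF // cos_gt0_pihalf // atan_gtNpi2 atan_ltpi2.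
by rewrite -{2}[s]atanK divfK.
Qed.

Lemma trig_poly_cos : trig_poly 1 (@cos R).
Proof.
exists (1 - 'X ^+ 2).
  by rewrite (leq_trans (size_polyD _ _)) // size_polyN size_polyXn size_poly1.
move=> s; rewrite cos_mulr2n !hornerE expr1.
have := sqr_cos_atan s; lra.
Qed.

Lemma trig_poly_sin : trig_poly 1 (@sin R).
Proof.
exists (2 *: 'X).
  by rewrite (leq_trans (size_scale_leq _ _)) // size_polyX.
move=> s; rewrite hornerZ hornerX sin_mulr2n sin_atan expr1.
transitivity (2 * s * ((1 + s ^+ 2) * cos (atan s) ^+ 2)); last by ring.
by rewrite sqr_cos_atan mulr1.
Qed.

Lemma trig_poly_cos_sin_muln n :
  trig_poly n (fun t : R => cos (t *+ n)) /\
  trig_poly n (fun t : R => sin (t *+ n)).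
Proof.
elim: n => [|n [IHc IHs]].
  split; [apply: eq_trig_poly (trig_polyC 1) |
          apply: eq_trig_poly (trig_polyC 0)] => t.
    by rewrite mulr0n cos0.
  by rewrite mulr0n sin0.
split.
  apply: eq_trig_poly (trig_polyD (trig_polyM trig_poly_cos IHc)
                (trig_polyZ (-1) (trig_polyM trig_poly_sin IHs))) => t.
  by rewrite mulrS cosD mulN1r.
apply: eq_trig_poly (trig_polyD (trig_polyM trig_poly_sin IHc)
              (trig_polyM trig_poly_cos IHs)) => t.
by rewrite mulrS sinD.
Qed.

Lemma trig_poly_cosB n (a : R) : trig_poly n (fun t => cos ((t - a) *+ n)).
Proof.
have [cos_n sin_n] := trig_poly_cos_sin_muln n.
apply: eq_trig_poly (trig_polyD (trig_polyZ (cos (a *+ n)) cos_n)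
                       (trig_polyZ (sin (a *+ n)) sin_n)) => t.
by rewrite mulrnBl cosB; ring.
Qed.

Lemma trig_poly_exp f k : trig_poly 1 f -> trig_poly k (fun t => f t ^+ k).
Proof.
move=> f1; elim: k => [|k IHk]; first exact: (trig_polyC 1).
by apply: eq_trig_poly (trig_polyM f1 IHk) => t; rewrite exprS.
Qed.

Lemma trig_poly_meval d n (P : mpoly d R) (v : R -> 'I_d -> R) :
    (mmeasure mdeg P <= n.+1)%N -> (forall i, trig_poly 1 (v ^~ i)) ->
  trig_poly n (fun t => meval (v t) P).
Proof.
move=> size_P v1.
apply: (eq_trig_poly (fun t => esym (mevalE (v t) P))).
(* The induction runs over any list of monomials of degree at most n. *)
suff sum_le (r : seq (multinom d)) : (forall m, m \in r -> (mdeg m <= n)%N) ->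
    trig_poly n (fun t => \sum_(m <- r) mcoeff m P * \prod_i v t i ^+ m i).
  apply: sum_le => m m_P; rewrite -ltnS.
  by apply: leq_trans size_P; apply: mmeasure_mnm_lt.
elim: r => [|m r IHr] deg_r.
  apply: eq_trig_poly (trig_poly_le (leq0n n) (trig_polyC 0)) => t.
  by rewrite big_nil.
have sum_r : trig_poly n (fun t =>
    \sum_(k <- r) mcoeff k P * \prod_i v t i ^+ k i).
  by apply: IHr => k k_r; apply: deg_r; rewrite inE k_r orbT.
suff monom_m : trig_poly n (fun t => \prod_i v t i ^+ m i).
  apply: eq_trig_poly (trig_polyD (trig_polyZ (mcoeff m P) monom_m) sum_r) => t.
  by rewrite big_cons.
apply: trig_poly_le (deg_r m (mem_head _ _)) _.
rewrite mdegE.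
elim: (index_enum _) => [|i s IHs].
  by rewrite big_nil; apply: eq_trig_poly (trig_polyC 1) => t; rewrite big_nil.
rewrite big_cons.
apply: eq_trig_poly (trig_polyM (trig_poly_exp (m i) (v1 i)) IHs) => t.
by rewrite big_cons.
Qed.

(** A trigonometric polynomial of degree at most n has at most 2 n zeros in
    ]-pi, pi[: the increasing substitution s = tan (t / 2) reduces this to the
    algebraic case. *)
Lemma trig_poly_alternating n f (tau : nat -> R) :
    trig_poly n f ->
    (forall j, (j <= (2 * n).+1)%N -> - pi < tau j < pi) ->
    (forall j, (j < (2 * n).+1)%N -> tau j < tau j.+1) ->
    (forall j, (j <= (2 * n).+1)%N -> 0 < (-1) ^+ j * f (tau j)) ->
  False.
Proof.
move=> [Q size_Q Q_s] tau_pi tau_incr f_alt.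
pose s j := tan (tau j / 2).
have tau_itv j : (j <= (2 * n).+1)%N -> tau j / 2 \in `](- (pi / 2)), (pi / 2)[.
  by move=> /tau_pi tau_j; rewrite in_itv /=; lra.
suff : ((2 * n).+1 < size Q)%N by rewrite ltnNge size_Q.
apply: (@alternating_size_gt _ _ s) => j le_j.
  rewrite ltr_tan ?tau_itv //; last exact: ltnW.
  by rewrite ltr_pM2r ?invr_gt0 // tau_incr.
rewrite Q_s /s tanK ?tau_itv // -[(tau j / 2) *+ 2]mulr_natr divfK ?pnatr_eq0 //.
by rewrite mulrCA mulr_gt0 ?f_alt // exprn_gt0 // ltr_pwDl // sqr_ge0.
Qed.

Lemma cos_muln_pi k : cos (pi *+ k) = (-1) ^+ k :> R.
Proof.
elim: k => [|k IHk]; first by rewrite mulr0n cos0.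
by rewrite mulrSr cosDpi IHk exprS mulN1r.
Qed.

(** * The zero nearest to a maximum *)

(** With h = pi / n, the points h *+ k - pi - a for 1 <= k <= 2 n fill one period,
    D alternates on them, and D is positive at the n-th one, -a, and negative at
    the next one, h - a.  The signs of D at 0 and theta, between these two, insert
    two more sign changes. *)
Lemma trig_poly_two_extra_signs n D (h a theta : R) :
    (0 < n)%N -> trig_poly n D -> h *+ n = pi -> 0 < a -> 0 < theta ->
    theta + a < h ->
    (forall k, 0 < (-1) ^+ (k + n) * D (h *+ k - pi - a)) ->
    D 0 < 0 -> 0 < D theta ->
  False.
Proof.
move=> n_gt0 D_n hn a0 theta_gt0 theta_lt Dk D0 Dtheta.
(* The points in increasing order: n extremal points up to -a, then 0 and
   theta, then the other n extremal points. *)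
pose tau j : R := if (j < n)%N then h *+ j.+1 - pi - a else
  if j == n then 0 else if j == n.+1 then theta else h *+ j.-1 - pi - a.
have h0 : 0 < h by rewrite -(@pmulrn_lgt0 _ h n) // hn pi_gt0.
have h_mono i k : (i <= k)%N -> h *+ i <= h *+ k by apply: ler_wpMn2l; apply: ltW.
have h_pi : h <= pi by rewrite -hn; apply: (h_mono 1).
have tau_lo j : (j < n)%N -> tau j = h *+ j.+1 - pi - a by rewrite /tau => ->.
have tau_n : tau n = 0 by rewrite /tau ltnn eqxx.
have tau_n1 : tau n.+1 = theta.
  by rewrite /tau ltnNge leqnSn (gtn_eqF (ltnSn n)) eqxx.
have tau_hi j : (n.+1 < j)%N -> tau j = h *+ j.-1 - pi - a.
  move=> lt_nj; have lt_j := ltnW lt_nj.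
  by rewrite /tau ltnNge (ltnW lt_j) (gtn_eqF lt_j) (gtn_eqF lt_nj).
have tau_cases (Q : nat -> Prop) : (forall j, (j < n)%N -> Q j) -> Q n ->
    Q n.+1 -> (forall j, (n.+1 < j)%N -> Q j) -> forall j, Q j.
  move=> Qlo Qn Qn1 Qhi j; case: (ltngtP j n) => [/Qlo //| |->//].
  by rewrite leq_eqVlt => /predU1P[<-//|/Qhi].
apply: (@trig_poly_alternating n (fun t => (-1) ^+ n.+1 * D t) tau).
- exact: trig_polyZ.
- apply: tau_cases => [k lt_k _|_|_|k lt_k le_k].
  + rewrite tau_lo //.
    by have := h_mono 1 k.+1 isT; have := h_mono _ _ lt_k; rewrite hn mulr1n; lra.
  + by rewrite tau_n; lra.
  + by rewrite tau_n1; lra.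
  + rewrite tau_hi //.
    have : h *+ k.-1 <= h *+ (n + n).
      by apply: h_mono; clear -n_gt0 lt_k le_k; lia.
    have : h *+ 1 <= h *+ k.-1 by apply: h_mono; clear -n_gt0 lt_k le_k; lia.
    by rewrite mulrnDr hn mulr1n; lra.
- have step k : h *+ k.+1 = h *+ k + h by rewrite mulrSr.
  apply: tau_cases => [k lt_k _|_|_|k lt_k _].
  + rewrite tau_lo //; case: (ltngtP k.+1 n) => [lt_k1||eq_k]; last 1 first.
    * by rewrite eq_k tau_n hn; lra.
    * by rewrite tau_lo // (step k.+1); lra.
    * by rewrite ltnNge lt_k.
  + by rewrite tau_n tau_n1.
  + by rewrite tau_n1 tau_hi //= step hn; lra.
  + rewrite !tau_hi //=; last exact: ltnW.
    by case: k lt_k => // k _; rewrite /= step; lra.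
- have sgn k j t : odd (j + n.+1) = odd k ->
      (-1) ^+ j * ((-1) ^+ n.+1 * D t) = (-1) ^+ k * D t.
    by move=> eq_odd; rewrite mulrA -exprD -signr_odd eq_odd signr_odd.
  apply: tau_cases => [k lt_k _|_|_|k lt_k _].
  + by rewrite tau_lo // (sgn (k.+1 + n)%N) //; clear; lia.
  + by rewrite tau_n (sgn 1) ?expr1 ?mulN1r ?oppr_gt0 //; clear; lia.
  + by rewrite tau_n1 (sgn 0) ?mul1r //; clear; lia.
  + rewrite tau_hi // (sgn (k.-1 + n)%N) //; clear -lt_k; lia.
Qed.

(** This is M. Riesz's lemma; see the opening comment for the comparison with a
    shifted cosine. *)
Lemma trig_poly_zero_far_from_max n f theta :
    (0 < n)%N -> trig_poly n f -> (forall t, `|f t| <= 1) -> f 0 = 1 ->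
    0 <= theta -> f theta = 0 ->
  pi / (2 * n%:R) <= theta.
Proof.
move=> n_gt0 f_n f_le1 f0 theta_ge0 f_theta; rewrite leNgt.
apply/negP => theta_lt.
have theta_gt0 : 0 < theta.
  rewrite lt_neqAle theta_ge0 andbT eq_sym; apply/eqP => theta0.
  by move: f_theta; rewrite theta0 f0 => /eqP; rewrite oner_eq0.
have pi0 : 0 < pi :> R := pi_gt0 R.
have n0 : 0 < n%:R :> R by rewrite ltr0n.
pose h : R := pi / n%:R.
have hn : h *+ n = pi by rewrite -mulr_natr divfK ?gt_eqF.
have h2 : pi / (2 * n%:R) = h / 2 by rewrite /h invfM; ring.
rewrite {}h2 in theta_lt.
have hn2 : (h / 2) *+ n = pi / 2 by rewrite -hn mulrnAl.
(* A positive shift such that theta + a, hence a, stays below h / 2: then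
   cos (n (t + a)) is below 1 at 0 and still positive at theta. *)
pose a := (h / 2 - theta) / 2.
have a0 : 0 < a by rewrite /a; lra.
have ah : a < h / 2 by rewrite /a; lra.
have an0 : 0 < a *+ n by rewrite pmulrn_lgt0.
have anpi : a *+ n < pi / 2 by rewrite -hn2 ltrMn2r n_gt0.
pose c := cos (a *+ n).
have c0 : 0 < c by apply: cos_gt0_pihalf; lra.
have c1 : c < 1.
  by rewrite /c -cos0 ltr_cos // in_itv /=; lra.
(* Any A with 1 < A < 1 / c serves; this is the harmonic mean of 1 and 1 / c. *)
pose A := 2 / (1 + c).
have A1 : 1 < A by rewrite /A ltr_pdivlMr; lra.
have Ac : A * c < 1 by rewrite /A mulrAC ltr_pdivrMr; lra.
pose C t : R := cos ((t - - a) *+ n).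
pose D t := A * C t + -1 * f t.
have D_n : trig_poly n D.
  by apply: trig_polyD; apply: trig_polyZ => //; apply: trig_poly_cosB.
have Dk k : 0 < (-1) ^+ (k + n) * D (h *+ k - pi - a).
  have -> : D (h *+ k - pi - a) = A * (-1) ^+ (k + n) - f (h *+ k - pi - a).
    rewrite /D mulN1r /C opprK subrK mulrnBl -mulrnA mulnC mulrnA hn cosB.
    rewrite !cos_muln_pi [sin (pi *+ n)]cos1sin0 ?mulr0 ?addr0 -?exprD //.
    by rewrite cos_muln_pi normrX normrN1 expr1n.
  rewrite mulrBr mulrCA -exprD addnn -mul2n exprM sqrrN !expr1n mulr1.
  rewrite subr_gt0 (le_lt_trans _ A1) // (le_trans (ler_norm _)) //.
  by rewrite normrM normrX normrN1 expr1n mul1r.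
have D0 : D 0 < 0.
  by rewrite /D f0 /C sub0r opprK -/c; lra.
have Dtheta : 0 < D theta.
  rewrite /D f_theta mulr0 addr0 mulr_gt0 //; first lra.
  have : 0 < (theta + a) *+ n by rewrite pmulrn_lgt0 //; lra.
  have : (theta + a) *+ n < pi / 2.
    by rewrite -hn2 ltrMn2r n_gt0 /a; lra.
  by move=> *; rewrite /C opprK; apply: cos_gt0_pihalf; lra.
by apply: (@trig_poly_two_extra_signs n D h a theta) => //; rewrite /a; lra.
Qed.

End TrigonometricPolynomials.

(** * Great circles *)

Section Dotprod.
Variables (R : realType) (d : nat).
Implicit Types u v w : 'rV[R]_d.

Lemma dotprodC u v : dotprod u v = dotprod v u.
Proof. by apply: eq_bigr => i _; rewrite mulrC. Qed.

Lemma dotprodDl u v w : dotprod (u + v) w = dotprod u w + dotprod v w.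
Proof.
by rewrite /dotprod -big_split; apply: eq_bigr => i _; rewrite mxE mulrDl.
Qed.

Lemma dotprodZl c u v : dotprod (c *: u) v = c * dotprod u v.
Proof.
by rewrite /dotprod mulr_sumr; apply: eq_bigr => i _; rewrite mxE mulrA.
Qed.

Lemma dotprodDr u v w : dotprod u (v + w) = dotprod u v + dotprod u w.
Proof. by rewrite dotprodC dotprodDl !(dotprodC u). Qed.

Lemma dotprodZr c u v : dotprod u (c *: v) = c * dotprod u v.
Proof. by rewrite dotprodC dotprodZl dotprodC. Qed.

Lemma dotprod_ge0 u : 0 <= dotprod u u.
Proof. by apply: sumr_ge0 => i _; apply: sqr_ge0. Qed.

Lemma dotprod_eq0 u : dotprod u u = 0 -> u = 0.
Proof.
move=> /psumr_eq0P u0; apply/rowP => i; rewrite mxE.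
by apply/eqP; rewrite -sqrf_eq0; apply/eqP/u0 => // j _; apply: sqr_ge0.
Qed.

Lemma unit_sphereE u : unit_sphere R d u <-> dotprod u u = 1.
Proof.
rewrite /unit_sphere /euclidean_norm /=; split=> [u1|->]; last exact: sqrtr1.
by rewrite -(sqr_sqrtr (dotprod_ge0 u)) u1 expr1n.
Qed.

(** This case of the Cauchy-Schwarz inequality expresses that u + v and u - v have
    nonnegative squared norms. *)
Lemma dotprod_unit_sphere u v :
  dotprod u u = 1 -> dotprod v v = 1 -> -1 <= dotprod u v <= 1.
Proof.
move=> u1 v1; have := dotprod_ge0 (u + v); have := dotprod_ge0 (u + (-1) *: v).
by rewrite !dotprodDl !dotprodDr !dotprodZl !dotprodZr (dotprodC v u) u1 v1; lra.
Qed.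

(** The vector q is z minus its component along p, normalized; the hypothesis
    excludes z = p and z = -p, for which that difference vanishes. *)
Lemma great_circle p z :
    dotprod p p = 1 -> dotprod z z = 1 -> -1 < dotprod p z < 1 ->
  exists q : 'rV[R]_d, (forall t, unit_sphere R d (cos t *: p + sin t *: q)) /\
    z = cos (angular_dist p z) *: p + sin (angular_dist p z) *: q.
Proof.
move=> p1 z1 /andP[lo hi]; rewrite /angular_dist.
set theta := acos _.
have cos_theta : cos theta = dotprod p z.
  by rewrite acosK // in_itv /= !ltW.
have sin_theta : sin theta != 0.
  by apply/eqP => /sin0cos1; rewrite cos_theta; case: ger0P; lra.
pose q := (sin theta)^-1 *: (z + (- cos theta) *: p).
exists q; split=> [t|]; last first.
  by rewrite scalerA divff // scale1r scaleNr addrC subrK.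
apply/unit_sphereE.
have pq : dotprod p q = 0.
  by rewrite dotprodZr dotprodDr dotprodZr p1 cos_theta mulr1 subrr mulr0.
have qq : dotprod q q = 1.
  rewrite {1}/q dotprodZl dotprodDl dotprodZl pq mulr0 addr0.
  rewrite dotprodZr dotprodDr dotprodZr z1 (dotprodC z p) -cos_theta.
  rewrite mulNr -expr2 -sin2cos2.
  by rewrite mulKf // mulVf.
clearbody q.
rewrite !dotprodDl !dotprodDr !dotprodZl !dotprodZr (dotprodC q p).
rewrite p1 pq qq.
by rewrite -[RHS](cos2Dsin2 t); ring.
Qed.

End Dotprod.

Theorem theorem1p1 (R : realType) (d n : nat) (hd : (1 <= d)%N) (hn : (1 <= n)%N)
    (P : mpoly d R) (hP : has_degree P n)
    (hP0 : ~ (forall x : 'rV[R]_d, unit_sphere R d x -> peval P x = 0))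
    (p : 'rV[R]_d) (hp : unit_sphere R d p)
    (hmax : forall x : 'rV[R]_d, unit_sphere R d x -> `|peval P x| <= `|peval P p|) :
  at_angular_dist_ge (pi / (2 * n%:R)) p (zero_set P `&` unit_sphere R d).
Proof.
move=> z [Pz /unit_sphereE z1].
have p1 := hp; rewrite unit_sphereE in p1.
have Pp : peval P p != 0.
  apply/eqP => Pp; apply: hP0 => x /hmax.
  by rewrite Pp normr0 normr_le0 => /eqP.
have pz_itv := dotprod_unit_sphere p1 z1.
have [pz_lo pz_hi] := andP pz_itv.
have [pz1|pz1] := eqVneq (dotprod p z) 1.
  (* Equality in Cauchy-Schwarz: z = p, where P does not vanish. *)
  have /dotprod_eq0 pz : dotprod (p + (-1) *: z) (p + (-1) *: z) = 0.
    rewrite !dotprodDl !dotprodDr !dotprodZl !dotprodZr (dotprodC z p).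
    by rewrite p1 z1 pz1; ring.
  case/eqP: Pp; rewrite -[RHS]Pz; congr peval; apply/eqP.
  by rewrite -subr_eq0 -scaleN1r pz.
have [pzN1|pzN1] := eqVneq (dotprod p z) (-1).
  (* Here z = -p, at angular distance pi from p. *)
  rewrite /angular_dist pzN1 acosN1 ler_pdivrMr ?mulr_gt0 ?ltr0n //.
  by rewrite ler_peMr ?pi_ge0 // -natrM ler1n muln_gt0.
have [|q [sphere_q z_q]] := great_circle p1 z1.
  by rewrite !lt_neqAle pz1 pz_lo pz_hi eq_sym pzN1.
pose x t := cos t *: p + sin t *: q.
(* Dividing by P p makes the maximum value 1 whatever the sign of P p. *)
apply: (@trig_poly_zero_far_from_max _ n
          (fun t => (peval P p)^-1 * peval P (x t))) => //.
- apply: trig_polyZ; apply: trig_poly_meval; first by rewrite hP.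
  move=> i; apply: (@eq_trig_poly _ _
            (fun t => p ord0 i * cos t + q ord0 i * sin t)).
    by move=> t; rewrite !mxE (mulrC (cos t)) (mulrC (sin t)).
  apply: trig_polyD; apply: trig_polyZ; first exact: trig_poly_cos.
  exact: trig_poly_sin.
- move=> t; rewrite normrM normfV ler_pdivrMl ?normr_gt0 // mulr1.
  exact: hmax (sphere_q t).
- by rewrite /x cos0 sin0 scale1r scale0r addr0 mulVf.
- exact: acos_ge0.
- by rewrite /x -z_q Pz mulr0.
Qed.
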